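(* Let $A\in\mathbb{R}^{n\times n}$ be nonsingular, let $\nu=\Vert A^{-1}\Vert$, and let $\tau\in\mathbb{R}$. If $$0<\nu<1\quad\text{and}\quad 0<\tau<\frac{2}{1+\nu},$$ then for any $b\in\mathbb{R}^n$ the equation $Ax-|x|-b=0$ has a unique solution $x^*\in\mathbb{R}^n$, and the sequence $\{(x^{(k)},y^{(k)})\}_{k=0}^\infty$ generated by the FPI iteration converges to $(x^*,y^* )$ with $y^*=|x^*|$ for any given initial vectors $x^{(0)},y^{(0)}\in\mathbb{R}^n$.
   Context: For $x\in\mathbb{R}^n$, $|x|$ is the componentwise absolute value. $\Vert\cdot\Vert$ is the matrix 2-norm. The FPI (fixed point iteration) for $Ax-|x|-b=0$ with parameter $\tau=\tau_{\rm FPI}$ is, for $k=0,1,2,\dots$, $$x^{(k+1)}=A^{-1}(y^{(k)}+b),\qquad y^{(k+1)}=(1-\tau)y^{(k)}+\tau|x^{(k+1)}|.$$ *)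

(* Defs.v *)
From mathcomp Require Import all_boot all_order all_algebra.
From mathcomp Require Import all_classical all_reals all_analysis.
Set Implicit Arguments.
Unset Strict Implicit.
Unset Printing Implicit Defensive.
Import Order.TTheory GRing.Theory Num.Theory.
Import numFieldNormedType.Exports.
Local Open Scope classical_set_scope.
Local Open Scope ring_scope.

Definition vec2norm (R : realType) (n : nat) (v : 'cV[R]_n) : R :=
  Num.sqrt (\sum_(i < n) v i 0 ^+ 2).

(* The matrix 2-norm, i.e. the operator norm induced by [vec2norm]; the
   library's own norm on matrices is the largest absolute value of an entry.
   The set below is bounded, and it is nonempty when 0 < n; for n = 0 its
   [sup] is 0 by convention, which is the norm of the empty matrix. *)
Definition mx2norm (R : realType) (m n : nat) (A : 'M[R]_(m, n)) : R :=
  sup [set vec2norm (A *m v) | v in [set v : 'cV[R]_n | vec2norm v = 1]].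

Definition absv (R : realType) (n : nat) (v : 'cV[R]_n) : 'cV[R]_n :=
  map_mx Num.norm v.

Definition ave_solution (R : realType) (n : nat) (A : 'M[R]_n)
    (b x : 'cV[R]_n) : Prop :=
  A *m x - absv x - b = 0.

Definition fpi_step (R : realType) (n : nat) (A : 'M[R]_n) (b : 'cV[R]_n)
    (tau : R) (p : 'cV[R]_n * 'cV[R]_n) : 'cV[R]_n * 'cV[R]_n :=
  let x' := invmx A *m (p.2 + b) in
  (x', (1 - tau) *: p.2 + tau *: absv x').

Definition fpi (R : realType) (n : nat) (A : 'M[R]_n) (b : 'cV[R]_n)
    (tau : R) (x0 y0 : 'cV[R]_n) (k : nat) : 'cV[R]_n * 'cV[R]_n :=
  iter k (fpi_step A b tau) (x0, y0).

(* Main.v *)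
From HB Require Import structures.
Require Import Defs.
From mathcomp Require Import all_boot all_order all_algebra.
From mathcomp Require Import all_classical all_reals all_analysis.
From mathcomp Require Import ring lra.
Set Implicit Arguments.
Unset Strict Implicit.
Unset Printing Implicit Defensive.
Import Order.TTheory GRing.Theory Num.Theory.
Import numFieldNormedType.Exports.
Local Open Scope classical_set_scope.
Local Open Scope ring_scope.

(** The sequence of the y^(k) runs an affine averaging of the map
    F y = |A^-1 (y + b)|: one step is y |-> (1 - tau) y + tau F y.  Taking
    componentwise absolute values does not increase Euclidean distances, so F
    is Lipschitz with constant nu = ||A^-1|| ([vec2norm_absv_lipschitz],
    [vec2norm_mulmx_le]).  As nu < 1, F has a fixed point ys
    ([vec2norm_contraction_fixpoint]), and xs = A^-1 (ys + b) satisfies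
    |xs| = ys, hence A xs - |xs| = b.  Two solutions x and z satisfy
    x - z = A^-1 (|x| - |z|), so ||x - z|| <= nu ||x - z|| and x = z.

    Since ys is also fixed by the averaged map, one step multiplies the error
    ||y^(k) - ys|| by at most q = |1 - tau| + tau nu.  This is below 1 exactly
    on the given range of tau when nu < 1: for tau <= 1 it is
    1 - tau (1 - nu), and for tau > 1 it is tau (1 + nu) - 1
    ([fpi_factor_lt1]).  The error decays geometrically, and so does
    x^(k+1) - xs = A^-1 (y^(k) - ys).

    The topology on column vectors comes from the maximum norm, whereas all
    the contraction estimates hold for the Euclidean norm; the inequalities
    |v|_max <= ||v|| <= sqrt n |v|_max carry results from one to the other. *)

(** Joins the complete uniform structure and the normed module structure of
    matrices, so that the Banach fixed point theorem applies to them. *)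
HB.instance Definition _ (R : realType) (m n : nat) :=
  NormedModule.on 'M[R]_(m, n).

(** * The Euclidean norm *)

Lemma vec2norm_ge0 (R : realType) (n : nat) (v : 'cV[R]_n) : 0 <= vec2norm v.
Proof. exact: sqrtr_ge0. Qed.

Lemma sqr_vec2norm (R : realType) (n : nat) (v : 'cV[R]_n) :
  vec2norm v ^+ 2 = \sum_(i < n) v i 0 ^+ 2.
Proof. by rewrite sqr_sqrtr // sumr_ge0 // => i _; exact: sqr_ge0. Qed.

Lemma normr_coord_le_vec2norm (R : realType) (n : nat) (v : 'cV[R]_n) i :
  `|v i 0| <= vec2norm v.
Proof.
rewrite -sqrtr_sqr ler_wsqrtr // (bigD1 i) //= lerDl sumr_ge0 // => j _.
exact: sqr_ge0.
Qed.

Lemma vec2norm_eq0 (R : realType) (n : nat) (v : 'cV[R]_n) :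
  vec2norm v = 0 -> v = 0.
Proof.
move=> v0; apply/colP => i; rewrite mxE; apply/eqP.
by rewrite -normr_le0 -v0 normr_coord_le_vec2norm.
Qed.

Lemma vec2normZ (R : realType) (n : nat) (a : R) (v : 'cV[R]_n) :
  vec2norm (a *: v) = `|a| * vec2norm v.
Proof.
rewrite /vec2norm -sqrtr_sqr -sqrtrM ?sqr_ge0 // mulr_sumr.
by congr Num.sqrt; apply: eq_bigr => i _; rewrite mxE exprMn.
Qed.

(** With a = ||u|| and b = ||v||, expanding 0 <= ||b u - a v||^2 gives
    0 <= 2 a b (a b - <u, v>). *)
Lemma vec2norm_cauchy_schwarz (R : realType) (n : nat) (u v : 'cV[R]_n) :
  \sum_(i < n) u i 0 * v i 0 <= vec2norm u * vec2norm v.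
Proof.
have [-> | u_neq0] := eqVneq u 0.
  by rewrite big1 ?mulr_ge0 ?vec2norm_ge0 // => i _; rewrite mxE mul0r.
have [-> | v_neq0] := eqVneq v 0.
  by rewrite big1 ?mulr_ge0 ?vec2norm_ge0 // => i _; rewrite mxE mulr0.
set a := vec2norm u; set b := vec2norm v; set s := \sum_(_ < _) _.
have a_gt0 : 0 < a.
  rewrite lt_neqAle vec2norm_ge0 andbT eq_sym.
  by apply: contra_neq u_neq0; exact: vec2norm_eq0.
have b_gt0 : 0 < b.
  rewrite lt_neqAle vec2norm_ge0 andbT eq_sym.
  by apply: contra_neq v_neq0; exact: vec2norm_eq0.
have : 0 <= \sum_(i < n) (b * u i 0 - a * v i 0) ^+ 2.
  by apply: sumr_ge0 => i _; exact: sqr_ge0.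
have -> : \sum_(i < n) (b * u i 0 - a * v i 0) ^+ 2 =
    a * b * (a * b - s) *+ 2.
  transitivity (b ^+ 2 * \sum_(i < n) u i 0 ^+ 2 - a * b * s *+ 2
      + a ^+ 2 * \sum_(i < n) v i 0 ^+ 2).
    rewrite !mulr_sumr -sumrMnl -sumrB -big_split /=.
    by apply: eq_bigr => i _; ring.
  by rewrite -!sqr_vec2norm -/a -/b; ring.
by rewrite pmulrn_lge0 // pmulr_rge0 ?mulr_gt0 // subr_ge0.
Qed.

Lemma vec2norm_triangle (R : realType) (n : nat) (u v : 'cV[R]_n) :
  vec2norm (u + v) <= vec2norm u + vec2norm v.
Proof.
rewrite -ler_sqr ?nnegrE ?addr_ge0 ?vec2norm_ge0 // sqrrD !sqr_vec2norm.
have -> : \sum_(i < n) (u + v) i 0 ^+ 2 =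
    \sum_(i < n) u i 0 ^+ 2 + (\sum_(i < n) u i 0 * v i 0) *+ 2
    + \sum_(i < n) v i 0 ^+ 2.
  rewrite -sumrMnl -!big_split /=; apply: eq_bigr => i _.
  by rewrite mxE sqrrD.
by rewrite lerD2r lerD2l lerMn2r vec2norm_cauchy_schwarz.
Qed.

Lemma vec2norm_absv_lipschitz (R : realType) (n : nat) (u v : 'cV[R]_n) :
  vec2norm (absv u - absv v) <= vec2norm (u - v).
Proof.
apply: ler_wsqrtr; apply: ler_sum => i _; rewrite !mxE.
by rewrite -real_normK ?num_real // -[leRHS]real_normK ?num_real // ler_sqr
  ?nnegrE // ler_dist_dist.
Qed.

Lemma mx_norm_le_vec2norm (R : realType) (n : nat) (v : 'cV[R]_n) :
  `|v| <= vec2norm v.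
Proof.
rewrite [leLHS]mx_normrE; apply: bigmax_le; first exact: vec2norm_ge0.
by case=> i j _ /=; rewrite ord1 normr_coord_le_vec2norm.
Qed.

Lemma vec2norm_le_mx_norm (R : realType) (n : nat) (v : 'cV[R]_n) :
  vec2norm v <= Num.sqrt n%:R * `|v|.
Proof.
rewrite -[`|v|]ger0_norm // -sqrtr_sqr -sqrtrM ?ler0n // ler_wsqrtr //.
have -> : n%:R * `|v| ^+ 2 = \sum_(i < n) `|v| ^+ 2.
  by rewrite sumr_const card_ord mulr_natl.
apply: ler_sum => i _.
rewrite -real_normK ?num_real // ler_sqr ?nnegrE //.
by rewrite [leRHS]mx_normrE; apply/bigmax_geP; right; exists (i, 0).
Qed.

(** * The induced matrix norm *)

(** A supremum over a set without upper bound is 0 by convention, so this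
    boundedness is what makes [mx2norm A] an actual upper bound. *)
Lemma vec2norm_mulmx_bounded (R : realType) (m n : nat) (A : 'M[R]_(m, n)) :
  has_ubound [set vec2norm (A *m v) | v in [set v : 'cV[R]_n | vec2norm v = 1]].
Proof.
exists (Num.sqrt m%:R * \sum_i \sum_j `|A i j|) => _ [v /= v1 <-].
apply: le_trans (vec2norm_le_mx_norm _) _; apply: ler_wpM2l => //.
rewrite [leLHS]mx_normrE; apply: bigmax_le => [|[i k] _ /=].
  by apply: sumr_ge0 => i _; apply: sumr_ge0.
rewrite ord1 mxE; apply: (le_trans (ler_norm_sum _ _ _)).
rewrite [leRHS](bigD1 i) //= ler_wpDr //.
  by apply: sumr_ge0 => j _; apply: sumr_ge0.
apply: ler_sum => j _; rewrite normrM ler_piMr //.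
by rewrite -v1 normr_coord_le_vec2norm.
Qed.

Lemma vec2norm_mulmx_le (R : realType) (m n : nat) (A : 'M[R]_(m, n))
    (v : 'cV[R]_n) :
  vec2norm (A *m v) <= mx2norm A * vec2norm v.
Proof.
have [v0 | v_neq0] := eqVneq (vec2norm v) 0.
  have := vec2normZ 0 (A *m v).
  by rewrite v0 (vec2norm_eq0 v0) mulmx0 scaler0 normr0 mul0r mulr0 => ->.
have v_gt0 : 0 < vec2norm v by rewrite lt_def v_neq0 vec2norm_ge0.
rewrite -ler_pdivrMr // mulrC.
rewrite -[(vec2norm v)^-1]ger0_norm ?invr_ge0 ?(ltW v_gt0) //.
rewrite -vec2normZ scalemxAr /mx2norm; apply: ub_le_sup.
  exact: vec2norm_mulmx_bounded.
exists ((vec2norm v)^-1 *: v) => //=.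
by rewrite vec2normZ ger0_norm ?invr_ge0 ?(ltW v_gt0) // mulVf.
Qed.

(** * Contractions for the Euclidean norm *)

Lemma vec2norm_iter_lipschitz (R : realType) (n : nat) (q : R)
    (f : 'cV[R]_n -> 'cV[R]_n) (k : nat) (u v : 'cV[R]_n) :
    0 <= q ->
    (forall u v, vec2norm (f u - f v) <= q * vec2norm (u - v)) ->
  vec2norm (iter k f u - iter k f v) <= q ^+ k * vec2norm (u - v).
Proof.
move=> q_ge0 f_lip; elim: k => [|k IHk]; first by rewrite mul1r.
by rewrite !iterS (le_trans (f_lip _ _)) // exprS -mulrA ler_wpM2l.
Qed.

Lemma vec2norm_contraction_eq (R : realType) (n : nat) (q : R)
    (u v : 'cV[R]_n) :
  q < 1 -> vec2norm (u - v) <= q * vec2norm (u - v) -> u = v.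
Proof.
move=> q_lt1 le_uv; apply/eqP; rewrite -subr_eq0; apply/eqP/vec2norm_eq0.
apply/eqP; rewrite eq_le vec2norm_ge0 andbT.
have := vec2norm_ge0 (u - v); nra.
Qed.

(** A Euclidean contraction need not contract the maximum norm, but its
    N-th iterate does as soon as q^N sqrt n < 1.  The Banach fixed point p of
    that iterate is also fixed by f: f p is another fixed point of the
    iterate, and a contraction has only one. *)
Lemma vec2norm_contraction_fixpoint (R : realType) (n : nat) (q : R)
    (f : 'cV[R]_n -> 'cV[R]_n) :
    0 <= q < 1 ->
    (forall u v, vec2norm (f u - f v) <= q * vec2norm (u - v)) ->
  exists p, f p = p.
Proof.
move=> /andP[q_ge0 q_lt1] f_lip.
have [N [c_lt1 qN_lt1]] : exists N, q ^+ N * Num.sqrt n%:R < 1 /\ q ^+ N < 1.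
  (* Both bounds follow from q^N (sqrt n + 1) < 1. *)
  have : q ^+ k * (Num.sqrt n%:R + 1) @[k --> \oo] --> 0 * (Num.sqrt n%:R + 1).
    by apply: cvgMl; apply: cvg_expr; rewrite ger0_norm.
  rewrite mul0r => /cvgrPdist_lt /(_ 1 ltr01) [N _ /(_ N (leqnn N))] qN_lt.
  exists N; move: qN_lt (exprn_ge0 N q_ge0) (sqrtr_ge0 (n%:R : R)) => /=.
  move: (q ^+ N) (Num.sqrt _) => a s; rewrite sub0r normrN => as_lt a_ge0 s_ge0.
  by move: as_lt; rewrite ger0_norm => [|]; [split|]; nra.
pose c := NngNum (mulr_ge0 (exprn_ge0 N q_ge0) (sqrtr_ge0 (n%:R : R))).
pose g : {fun [set: 'cV[R]_n] >-> [set: 'cV[R]_n]} := totalfun (iter N f).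
have g_contr : is_contraction g.
  exists c; split=> // -[u v] _ /=.
  apply: (le_trans (mx_norm_le_vec2norm _)).
  apply: (le_trans (vec2norm_iter_lipschitz N u v q_ge0 f_lip)).
  by rewrite -mulrA ler_wpM2l ?exprn_ge0 // vec2norm_le_mx_norm.
have [p _ pE] := banach_fixed_point g_contr closedT (ex_intro _ 0 I).
exists p; apply: (@vec2norm_contraction_eq _ _ (q ^+ N)) => //.
have {1}-> : f p = iter N f (f p) by rewrite -iterSr iterS -[iter N f p]pE.
rewrite {2}pE; exact: vec2norm_iter_lipschitz.
Qed.

Lemma cvg_geometric_vec2norm (R : realType) (n : nat) (q C : R)
    (u : nat -> 'cV[R]_n) (l : 'cV[R]_n) :
    0 <= q < 1 -> (forall k, vec2norm (u k - l) <= q ^+ k * C) ->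
  u k @[k --> \oo] --> l.
Proof.
move=> /andP[q_ge0 q_lt1] u_le; apply/subr_cvg0; apply: norm_cvg0.
have bound_cvg : q ^+ k * C @[k --> \oo] --> 0.
  rewrite -[X in _ --> X](mul0r C); apply: cvgMl; apply: cvg_expr.
  by rewrite ger0_norm.
apply: (squeeze_cvgr _ (cvg_cst 0) bound_cvg); apply: nearW => k.
by rewrite normr_ge0 (le_trans (mx_norm_le_vec2norm _)).
Qed.

(** * The fixed point iteration *)

Lemma fpi_factor_lt1 (R : realType) (nu tau : R) :
  0 < nu < 1 -> 0 < tau < 2 / (1 + nu) -> `|1 - tau| + tau * nu < 1.
Proof.
move=> /andP[nu_gt0 nu_lt1] /andP[tau_gt0].
rewrite ltr_pdivlMr; last by lra.
by move=> tau_lt; case: (ler0P (1 - tau)) => _; nra.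
Qed.

Lemma ave_solutionE (R : realType) (n : nat) (A : 'M[R]_n) (b x : 'cV[R]_n) :
  A \in unitmx -> ave_solution A b x <-> x = invmx A *m (absv x + b).
Proof.
move=> A_unit; split=> [/eqP | xE]; rewrite /ave_solution.
  by rewrite -addrA -opprD subr_eq0 => /eqP <-; rewrite mulKmx.
by rewrite {1}xE mulKVmx // -addrA -opprD subrr.
Qed.

Theorem corollary11 (R : realType) (n : nat) (A : 'M[R]_n) (nu tau : R)
    (A_nonsingular : A \in unitmx)
    (nuE : nu = mx2norm (invmx A))
    (nu_bounds : 0 < nu < 1)
    (tau_bounds : 0 < tau < 2 / (1 + nu)) :
  forall b : 'cV[R]_n,
    exists xs : 'cV[R]_n,
      unique (ave_solution A b) xs /\
      forall x0 y0 : 'cV[R]_n,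
        fpi A b tau x0 y0 k @[k --> \oo] --> (xs, absv xs).
Proof.
move=> b.
have q_lt1 := fpi_factor_lt1 nu_bounds tau_bounds.
case/andP: nu_bounds tau_bounds => nu_gt0 nu_lt1 /andP[tau_gt0 _].
pose T (y : 'cV[R]_n) := invmx A *m (y + b).
have T_lip y z : vec2norm (T y - T z) <= nu * vec2norm (y - z).
  rewrite nuE -mulmxBr.
  have -> : y + b - (z + b) = y - z by rewrite opprD addrACA subrr addr0.
  exact: vec2norm_mulmx_le.
have [|y z|ys ysE] := @vec2norm_contraction_fixpoint R n nu (@absv R n \o T).
- by rewrite ltW.
- exact: le_trans (vec2norm_absv_lipschitz _ _) (T_lip y z).
exists (T ys); split.
  split=> [|x /(ave_solutionE _ _ A_nonsingular) xE].
    by apply/ave_solutionE => //; rewrite [absv _]ysE.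
  apply: (@vec2norm_contraction_eq _ _ nu) => //.
  rewrite {1}xE -/(T _) (le_trans (T_lip _ _)) // ler_wpM2l ?(ltW nu_gt0) //.
  by rewrite -{1}ysE vec2norm_absv_lipschitz.
move=> x0 y0; pose q := `|1 - tau| + tau * nu.
have q_bounds : 0 <= q < 1 by rewrite q_lt1 andbT addr_ge0 // mulr_ge0 // ltW.
rewrite [absv _]ysE.
pose p := fpi A b tau x0 y0; pose C := vec2norm (y0 - ys).
have y_le k : vec2norm ((p k).2 - ys) <= q ^+ k * C.
  elim: k => [|k IHk]; first by rewrite mul1r.
  have -> : (p k.+1).2 - ys =
      (1 - tau) *: ((p k).2 - ys) + tau *: (absv (T (p k).2) - absv (T ys)).
    rewrite [absv (T ys)]ysE /p /fpi iterS /=.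
    by rewrite !scalerBr addrACA -opprD -scalerDl subrK scale1r.
  rewrite (le_trans (vec2norm_triangle _ _)) // !vec2normZ (gtr0_norm tau_gt0).
  rewrite exprS -mulrA; apply: (@le_trans _ _ (q * vec2norm ((p k).2 - ys))).
    rewrite [leRHS]mulrDl lerD2l -mulrA ler_wpM2l ?(ltW tau_gt0) //.
    exact: le_trans (vec2norm_absv_lipschitz _ _) (T_lip _ _).
  by rewrite ler_wpM2l //; case/andP: q_bounds.
have y_cvg : (p k).2 @[k --> \oo] --> ys.
  exact: cvg_geometric_vec2norm q_bounds y_le.
have x_cvg : (p k).1 @[k --> \oo] --> T ys.
  (* The start x0 is arbitrary: the geometric bound begins with x^(1). *)
  rewrite -cvg_shiftS.
  apply: (@cvg_geometric_vec2norm _ _ q (nu * C)) => // k.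
  rewrite /p /fpi iterS /= -/(T _) (le_trans (T_lip _ _)) //.
  by rewrite mulrCA ler_wpM2l ?(ltW nu_gt0) //; exact: y_le.
have -> : fpi A b tau x0 y0 = fun k => ((p k).1, (p k).2).
  by apply/funext => k; rewrite -surjective_pairing.
exact: cvg_pair x_cvg y_cvg.
Qed.
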